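(* Let $(p,q)$ and $(p',q')$ be two pairs of non-zero integers such that $pq=p'q'$ and $p\neq \pm p'$, $p\neq\pm q'$. Then at least one of the groups $\pi_{1}(K_{p,q}(0))$ and $\pi_{1}(K_{p',q'}(0))$ admits a generalized torsion element.
   Context: Notation: $[g,h]=g^{-1}h^{-1}gh$ and $g^{h}=h^{-1}gh$. A generalized torsion element of a group $F$ is a non-trivial element $g\in F$ for which there exist a positive integer $n$ and $h_1,\dots,h_n\in F$ with $g^{h_1}g^{h_2}\cdots g^{h_n}=1$. For non-zero integers $p,q$, $K_{p,q}\subset S^3$ denotes the double twist knot of type $(p,q)$: the two-bridge knot with Conway notation $C[2p,2q]$ (continued fraction $2p+\frac{1}{2q}$), with conventions such that $K_{1,1}$ is the figure eight knot and $K_{1,-1}$ is the right-handed trefoil. $K_{p,q}(0)$ denotes the closed 3-manifold obtained from $S^3$ by $0$-surgery along $K_{p,q}$. Its fundamental group has the presentation $$\pi_1(K_{p,q}(0))=\langle a,b,t \mid ta^{p}t^{-1}=b^{-1}a^{p},\ tb^{-q}a^{-1}t^{-1}=b^{-q},\ [b^{q},a^{p}]=1\rangle,$$ where $t$ is a meridian of $K_{p,q}$ and $[b^q,a^p]$ is the canonical longitude. *)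

(* Defs.v *)
From HB Require Import structures.
From mathcomp Require Import all_boot all_order all_algebra.
From mathcomp Require Import boolp.

Set Implicit Arguments.
Unset Strict Implicit.
Unset Printing Implicit Defensive.

Local Open Scope group_scope.
Local Open Scope quotient_scope.

Definition zexpg (G : baseGroupType) (x : G) (n : int) : G :=
  match n with Posz k => x ^+ k | Negz k => x ^- k.+1 end.

Inductive gterm (X : Type) : Type :=
| Gen of X
| One
| Mul of gterm X & gterm X
| Inv of gterm X.

Arguments One {X}.

(* No group axiom holds in [gterm X]: the instances only make the notations
   1, *, ^-1, ^+ and [~ _, _] available for writing relations. *)
HB.instance Definition _ (X : Type) := gen_eqMixin (gterm X).
HB.instance Definition _ (X : Type) := gen_choiceMixin (gterm X).
HB.instance Definition _ (X : Type) := hasMul.Build (gterm X) (@Mul X).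
HB.instance Definition _ (X : Type) := hasOne.Build (gterm X) One.
HB.instance Definition _ (X : Type) := hasInv.Build (gterm X) (@Inv X).

Section Presentation.

Variables (X : Type) (rels : seq (gterm X * gterm X)).

(* A pair [(u, v)] in [rels] stands for the relation u = v. *)
Inductive pres_eq : gterm X -> gterm X -> Prop :=
| pres_rel u v of (u, v) \in rels : pres_eq u v
| pres_refl u : pres_eq u u
| pres_sym u v of pres_eq u v : pres_eq v u
| pres_trans u v w of pres_eq u v & pres_eq v w : pres_eq u w
| pres_mul u u' v v' of pres_eq u u' & pres_eq v v' :
    pres_eq (u * v) (u' * v')
| pres_inv u u' of pres_eq u u' : pres_eq u^-1 u'^-1
| pres_mulA u v w : pres_eq (u * (v * w)) (u * v * w)
| pres_mul1 u : pres_eq (1 * u) u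
| pres_1mul u : pres_eq (u * 1) u
| pres_mulV u : pres_eq (u^-1 * u) 1
| pres_Vmul u : pres_eq (u * u^-1) 1.

Definition pres_eqb (u v : gterm X) : bool := `[< pres_eq u v >].

Fact pres_eqb_refl : reflexive pres_eqb.
Proof. by move=> u; apply/asboolP/pres_refl. Qed.

Fact pres_eqb_sym : symmetric pres_eqb.
Proof. by move=> u v; apply/asboolP/asboolP => /pres_sym. Qed.

Fact pres_eqb_trans : transitive pres_eqb.
Proof.
by move=> v u w /asboolP uv /asboolP vw; apply/asboolP/(pres_trans uv vw).
Qed.

Canonical pres_eqb_equiv :=
  EquivRel pres_eqb pres_eqb_refl pres_eqb_sym pres_eqb_trans.

(* The group < X | rels >. *)
Definition presented := {eq_quot pres_eqb_equiv}.
HB.instance Definition _ := Choice.on presented.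
HB.instance Definition _ := EqQuotient.on presented.

Fact pres_eqP (u v : gterm X) : (u = v %[mod presented]) <-> pres_eq u v.
Proof.
by split=> [/eqP|uv]; [|apply/eqP]; rewrite eqmodE; [move/asboolP|apply/asboolP].
Qed.

Definition pres_op1 : presented := \pi_presented 1.
Definition pres_opM (x y : presented) : presented := \pi_presented (repr x * repr y).
Definition pres_opV (x : presented) : presented := \pi_presented (repr x)^-1.

Fact pres_repr (u : gterm X) : pres_eq (repr (\pi_presented u)) u.
Proof. by apply/pres_eqP; rewrite reprK. Qed.

Fact pres_opMA : associative pres_opM.
Proof.
move=> x y z; apply/pres_eqP.
apply: (pres_trans (pres_mul (pres_refl _) (pres_repr _))).
apply: (pres_trans (pres_mulA _ _ _)).
exact: pres_mul (pres_sym (pres_repr _)) (pres_refl _).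
Qed.

Fact pres_op1M : left_id pres_op1 pres_opM.
Proof.
move=> x; rewrite -[RHS]reprK; apply/pres_eqP.
exact: pres_trans (pres_mul (pres_repr _) (pres_refl _)) (pres_mul1 _).
Qed.

Fact pres_opM1 : right_id pres_op1 pres_opM.
Proof.
move=> x; rewrite -[RHS]reprK; apply/pres_eqP.
exact: pres_trans (pres_mul (pres_refl _) (pres_repr _)) (pres_1mul _).
Qed.

Fact pres_opVM : left_inverse pres_op1 pres_opV pres_opM.
Proof.
move=> x; apply/pres_eqP.
exact: pres_trans (pres_mul (pres_repr _) (pres_refl _)) (pres_mulV _).
Qed.

Fact pres_opMV : right_inverse pres_op1 pres_opV pres_opM.
Proof.
move=> x; apply/pres_eqP.
exact: pres_trans (pres_mul (pres_refl _) (pres_repr _)) (pres_Vmul _).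
Qed.

HB.instance Definition _ :=
  isGroup.Build presented pres_opMA pres_op1M pres_opM1 pres_opVM pres_opMV.

End Presentation.

Inductive knot_gen := gen_a | gen_b | gen_t.

(* ASCII rendering of
   t a^p t^-1 = b^-1 a^p,  t b^-q a^-1 t^-1 = b^-q,  [b^q, a^p] = 1;
   [~ x, y] is x^-1 y^-1 x y. *)
Definition double_twist_rels (p q : int) : seq (gterm knot_gen * gterm knot_gen) :=
  let a := Gen gen_a in
  let b := Gen gen_b in
  let t := Gen gen_t in
  [:: (t * zexpg a p * t^-1, b^-1 * zexpg a p);
      (t * zexpg b (- q)%R * a^-1 * t^-1, zexpg b (- q)%R);
      ([~ zexpg b q, zexpg a p], 1)].

(* pi_1 (K_{p,q}(0)), where K_{p,q} is the double twist knot C[2p,2q]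
   (K_{1,1} the figure eight knot, K_{1,-1} the right-handed trefoil) and
   K_{p,q}(0) is its 0-surgery, is given by its standard presentation: the
   generator t is a meridian and [b^q, a^p] is the canonical longitude. *)
Definition pi1_zero_surgery (p q : int) : groupType :=
  presented (double_twist_rels p q).

Definition generalized_torsion (G : groupType) (g : G) : Prop :=
  g <> 1 /\
  exists (n : nat) (h : 'I_n -> G), (0 < n)%N /\ \prod_(i < n) (g ^ h i) = 1.

(* Main.v *)
Require Import Defs.
From HB Require Import structures.
From mathcomp Require Import all_boot all_order all_algebra.
From mathcomp Require Import boolp zify.

(** Write G for the group of the 0-surgery on K_{p,q}. The relation
    [a^p, b^q] = 1 alone is a source of generalized torsion: for m, n > 0 the
    commutator [a^m, b^n] is a product of conjugates of [a, b] ([commg_powers]),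
    so [a, b] is a generalized torsion element of G as soon as a and b do not
    commute ([commutator_torsion]).

    They do not commute when |pq| > 1. Geometrically, G is an HNN extension of
    H = < a, b | [a^p, b^q] = 1 >, the group of the 3-manifold obtained by
    cutting K_{p,q}(0) along the torus that caps off a genus one Seifert
    surface, and H embeds in G. To separate ab from ba it is enough to see the
    quotient Q of H given by the integral Heisenberg group with its centre
    reduced modulo pq. The two subgroups that t conjugates,
    < a^p, b^-q a^-1 > and < b^-1 a^p, b^-q >, both map injectively to the
    abelianization Z^2 of Q, with determinant -pq. Hence each of them is a copy
    of Z^2 acting freely on the set Q by translations, and a single subset of Q
    is a transversal for the orbits of both. Two free actions of Z^2 with a
    common transversal are conjugate in the group of all permutations of the
    set ([conj_commuting_pairs]). A conjugating permutation is a valid image for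
    t ([heisenberg_action]), so G acts on Q, and in this action a and b do not
    commute ([pi1_commutator_neq1]).

    Finally, if |pq| = 1 then p, q, p' and q' are all 1 or -1, which the
    hypotheses exclude; so the first of the two groups already has generalized
    torsion. *)

Set Implicit Arguments.
Unset Strict Implicit.
Unset Printing Implicit Defensive.

Import GRing.Theory.

Local Open Scope group_scope.

(** * Integer powers *)

Section IntegerPowers.

Variable G : groupType.
Implicit Types (x y : G) (m n : int).

Lemma zexpgN x n : zexpg x (- n)%R = (zexpg x n)^-1.
Proof.
by case: n => [[|n]|n] /=; rewrite ?invg1 ?invgK.
Qed.

Lemma zexpg1D x n : zexpg x (1 + n)%R = x * zexpg x n.
Proof.
case: n => [n|[|n]]; [exact: expgS|by rewrite /= mulgV|].
have -> : (1 + Negz n.+1)%R = Negz n by lia.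
by rewrite /= [in RHS]expgSr invgM mulVKg.
Qed.

Lemma zexpgD x m n : zexpg x (m + n)%R = zexpg x m * zexpg x n.
Proof.
elim: m => [|m IHm|m IHm]; first by rewrite add0r mul1g.
  have -> : (m.+1%:Z + n = 1 + (m%:Z + n))%R by lia.
  have -> : (m.+1%:Z = 1 + m%:Z)%R by lia.
  by rewrite !zexpg1D IHm mulgA.
apply: (mulgI x); rewrite mulgA -!zexpg1D.
have -> : (1 + (- m.+1%:Z + n) = - m%:Z + n)%R by lia.
by have -> : (1 - m.+1%:Z = - m%:Z)%R by lia.
Qed.

Lemma commute_zexpg x y n : commute x y -> commute x (zexpg y n).
Proof.
by case: n => n xy; [|apply: commuteV]; apply: commuteX.
Qed.

Lemma zexpg_additive (f : int -> G) :
  {morph f : m n / (m + n)%R >-> m * n} -> forall n, zexpg (f 1%R) n = f n.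
Proof.
move=> fD; have f0 : f 0%R = 1.
  by apply: (mulgI (f 0%R)); rewrite -fD addr0 mulg1.
elim=> [|n IHn|n IHn]; first by rewrite f0.
  have -> : (n.+1%:Z = 1 + n%:Z)%R by lia.
  by rewrite zexpg1D fD IHn.
apply: (mulgI (f 1%R)); rewrite -zexpg1D -fD.
by have -> : (1 - n.+1%:Z = - n%:Z)%R by lia.
Qed.

End IntegerPowers.

(** * Commutators of powers as products of conjugates *)

Section ConjugateProducts.

Variable G : groupType.
Implicit Types (w x y g : G) (m n : nat).

Definition conj_product w g : Prop :=
  exists2 s : seq G, s != [::] & \prod_(h <- s) (w ^ h) = g.

Lemma conj_product_self w : conj_product w w.
Proof. by exists [:: 1] => //; rewrite big_seq1 conjg1. Qed.

Lemma conj_productM w g1 g2 :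
  conj_product w g1 -> conj_product w g2 -> conj_product w (g1 * g2).
Proof.
move=> [s1 s1n <-] [s2 s2n <-]; exists (s1 ++ s2); last by rewrite big_cat.
by case: s1 s1n.
Qed.

Lemma conj_productJ w g h : conj_product w g -> conj_product w (g ^ h).
Proof.
move=> [s sn <-]; exists [seq k * h | k <- s]; first by case: s sn.
by rewrite conjg_prod big_map; apply: eq_bigr => k _; rewrite conjgM.
Qed.

Lemma commMg x1 x2 y : [~ x1 * x2, y] = [~ x1, y] ^ x2 * [~ x2, y].
Proof.
rewrite !commgEr conjMg -conjgM -(mulgA _ (y ^ x2)) (mulgA (y ^ x2)) -conjMg.
by rewrite mulgV conj1g mul1g. Qed.

Lemma commgM x y1 y2 : [~ x, y1 * y2] = [~ x, y2] * [~ x, y1] ^ y2.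
Proof. by rewrite -[LHS]invgK invgR commMg invgM -conjVg !invgR. Qed.

Lemma commg_power_r x y n : conj_product [~ x, y] [~ x, y ^+ n.+1].
Proof.
elim: n => [|n IHn]; first exact: conj_product_self.
rewrite expgSr commgM; apply: conj_productM; first exact: conj_product_self.
exact: conj_productJ.
Qed.

Lemma commg_powers x y m n :
  conj_product [~ x, y] [~ x ^+ m.+1, y ^+ n.+1].
Proof.
elim: m => [|m IHm]; first exact: commg_power_r.
rewrite expgSr commMg; apply: conj_productM; first exact: conj_productJ.
exact: commg_power_r.
Qed.

(** Commutation with an element and with its inverse are the same, so the signs
    of the exponents can be discarded before [commg_powers] is applied. *)
Lemma commutator_torsion x y (p q : int) : p <> 0%R -> q <> 0%R ->
  commute (zexpg x p) (zexpg y q) -> [~ x, y] <> 1 ->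
  generalized_torsion [~ x, y].
Proof.
move=> p0 q0 xpyq xy; split=> //.
have [m xm] : exists m, commute (x ^+ m.+1) (zexpg y q).
  case: p p0 xpyq => [[|m]|m] //= _ H; exists m => //.
  by rewrite -(invgK (x ^+ _)); apply/commute_sym/commuteV/commute_sym.
have [n xmyn] : exists n, commute (x ^+ m.+1) (y ^+ n.+1).
  case: q q0 xm {xpyq} => [[|n]|n] //= _ H; exists n => //.
  by rewrite -(invgK (y ^+ _)); apply: commuteV.
have [s sn sE] := commg_powers x y m n.
exists (size s), (tnth (in_tuple s)); split; first by case: s sn {sE}.
rewrite -(big_tnth _ _ s xpredT (fun h => [~ x, y] ^ h)) sE.
exact/eqP/commgP.
Qed.

End ConjugateProducts.

(** * Evaluation of group terms *)

Section Evaluation.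

Variables (X : Type) (G : groupType) (f : X -> G).

Fixpoint gterm_eval (u : gterm X) : G :=
  match u with
  | Gen x => f x
  | One => 1
  | Mul u v => gterm_eval u * gterm_eval v
  | Inv u => (gterm_eval u)^-1
  end.

Lemma gterm_eval_zexpg u n :
  gterm_eval (zexpg u n) = zexpg (gterm_eval u) n.
Proof.
have evalX k : gterm_eval (u ^+ k) = gterm_eval u ^+ k.
  by case: k => // k; elim: k => // k IHk; rewrite !expgSS -IHk.
by case: n => n /=; rewrite evalX.
Qed.

Lemma gterm_eval_pres rels :
  (forall r, r \in rels -> gterm_eval r.1 = gterm_eval r.2) ->
  forall u v, pres_eq rels u v -> gterm_eval u = gterm_eval v.
Proof.
move=> relsE u v; elim=> //=.
- by move=> {}u {}v /relsE.
- by move=> {}u {}v w _ -> _ ->.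
- by move=> {}u u' {}v v' _ -> _ ->.
- by move=> {}u u' _ ->.
- by move=> *; rewrite mulgA.
- by move=> *; rewrite mul1g.
- by move=> *; rewrite mulg1.
- by move=> *; rewrite mulVg.
- by move=> *; rewrite mulgV.
Qed.

End Evaluation.

Definition pres_gen X (rels : seq (gterm X * gterm X)) (x : X) :
  presented rels := (\pi_(presented rels) (Gen x))%qT.

Lemma pi_gterm_eval X (rels : seq (gterm X * gterm X)) (u : gterm X) :
  (\pi_(presented rels) u)%qT = gterm_eval (@pres_gen X rels) u.
Proof.
elim: u => //= [u <- v <-|u <-]; apply/pres_eqP/pres_sym.
  by apply: pres_mul; apply: pres_repr.
by apply: pres_inv; apply: pres_repr.
Qed.

(** * The group of permutations of a type *)

(** The inverse is part of the data, so that composites and inverses are given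
    by formulas; it is determined by the function, so equality is still
    pointwise. *)
Record bijection (X : Type) := Bijection {
  bij_fun :> X -> X;
  bij_inv : X -> X;
  bij_funK : cancel bij_fun bij_inv;
  bij_invK : cancel bij_inv bij_fun
}.

Lemma bijection_ext X (f g : bijection X) : f =1 g -> f = g.
Proof.
case: f g => [f f' fK f'K] [g g' gK g'K] /= /funext fg.
rewrite {f}fg in fK f'K *.
have f'g' : f' = g' by apply/funext => x; rewrite -{1}[x]g'K fK.
by rewrite {f'}f'g' in fK f'K *; congr Bijection; apply: Prop_irrelevance.
Qed.

HB.instance Definition _ X := gen_eqMixin (bijection X).
HB.instance Definition _ X := gen_choiceMixin (bijection X).

Section BijectionGroup.

Variable X : Type.
Implicit Types f g : bijection X.

Definition bij_one : bijection X :=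
  @Bijection X id id (fun=> erefl) (fun=> erefl).

Definition bij_comp f g : bijection X :=
  Bijection (can_comp (bij_funK f) (bij_funK g))
            (can_comp (bij_invK g) (bij_invK f)).

Definition bij_sym f : bijection X := Bijection (bij_invK f) (bij_funK f).

Fact bij_compA : associative bij_comp.
Proof. by move=> f g h; apply: bijection_ext. Qed.

Fact bij_comp1f : left_id bij_one bij_comp.
Proof. by move=> f; apply: bijection_ext. Qed.

Fact bij_compf1 : right_id bij_one bij_comp.
Proof. by move=> f; apply: bijection_ext. Qed.

Fact bij_compVf : left_inverse bij_one bij_sym bij_comp.
Proof. by move=> f; apply: bijection_ext => x; apply: bij_funK. Qed.

Fact bij_compfV : right_inverse bij_one bij_sym bij_comp.
Proof. by move=> f; apply: bijection_ext => x; apply: bij_invK. Qed.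

HB.instance Definition _ :=
  isGroup.Build (bijection X)
    bij_compA bij_comp1f bij_compf1 bij_compVf bij_compfV.

Lemma bijM f g x : (f * g) x = f (g x). Proof. by []. Qed.

End BijectionGroup.

(** * Conjugating two free actions of a rank two lattice *)

Section ConjugateActions.

Variables (X : Type) (V : zmodType).

Lemma zexpg_translates (g : bijection X) (c : X -> V) (e : V) :
    (forall z, c (g z) = e + c z)%R ->
  forall n z, c (zexpg g n z) = (e *~ n + c z)%R.
Proof.
move=> cg; elim=> [|n IHn|n IHn] z; first by rewrite mulr0z add0r.
  have -> : (n.+1%:Z = 1 + n%:Z)%R by lia.
  by rewrite zexpg1D bijM cg IHn mulrzDr mulr1z addrA.
apply: (@addrI _ e); rewrite -cg -bijM -zexpg1D addrA.
rewrite -[X in (X + _ *~ _)%R]mulr1z -mulrzDr.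
by have -> : (1 - n.+1%:Z = - n%:Z)%R by lia.
Qed.

(** The map [c] identifies each orbit of [r] with [V], and the zero fibre of [c]
    is a transversal of the orbits; the conjugating permutation is the identity
    on the common transversal, extended equivariantly. *)
Lemma conj_free_actions (r r' : V -> bijection X) (c c' : X -> V) :
    {morph r : u v / (u + v)%R >-> u * v} ->
    {morph r' : u v / (u + v)%R >-> u * v} ->
    (forall v z, c (r v z) = v + c z)%R ->
    (forall v z, c' (r' v z) = v + c' z)%R ->
    (forall z, c z = 0%R <-> c' z = 0%R) ->
  exists t : bijection X, forall v, t * r v * t^-1 = r' v.
Proof.
have morph0 (s : V -> bijection X) : {morph s : u v / (u + v)%R >-> u * v} ->
    s 0%R = 1.
  by move=> sD; apply: (mulgI (s 0%R)); rewrite -sD addr0 mulg1.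
have transportK (s s' : V -> bijection X) (d d' : X -> V) :
    {morph s : u v / (u + v)%R >-> u * v} ->
    {morph s' : u v / (u + v)%R >-> u * v} ->
    (forall v z, d (s v z) = v + d z)%R ->
    (forall v z, d' (s' v z) = v + d' z)%R ->
    (forall z, d z = 0%R <-> d' z = 0%R) ->
    cancel (fun z => s' (d z) (s (- d z)%R z))
           (fun z => s (d' z) (s' (- d' z)%R z)).
  move=> sD s'D ds d's' dd' z.
  have d'0 : d' (s (- d z)%R z) = 0%R by apply/dd'; rewrite ds addNr.
  rewrite d's' d'0 addr0 -[s' _ (s' _ _)]bijM -s'D addNr morph0 //=.
  by rewrite -[LHS]bijM -sD subrr morph0.
move=> rD r'D cr c'r' cc'.
have c'c z : c' z = 0%R <-> c z = 0%R by apply: iff_sym.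
pose t := Bijection (transportK r r' c c' rD r'D cr c'r' cc')
                    (transportK r' r c' c r'D rD c'r' cr c'c).
exists t => v; apply: (mulIg t); rewrite mulgVK; apply: bijection_ext => z.
rewrite !bijM /= cr r'D bijM -[r _ (r v z)]bijM -rD.
by rewrite opprD addrAC addNr add0r.
Qed.

End ConjugateActions.

Section CommutingPairs.

Variable X : Type.
Implicit Types (a b : bijection X) (c : X -> int * int).

Let pair_action a b (v : int * int) := zexpg a v.1 * zexpg b v.2.

Lemma pair_actionD a b : commute a b ->
  {morph pair_action a b : u v / (u + v)%R >-> u * v}.
Proof.
move=> ab u v; rewrite /pair_action /= !zexpgD !mulgA.
congr (_ * _); rewrite -!mulgA; congr (_ * _).
by apply: commute_zexpg; apply/commute_sym/commute_zexpg.
Qed.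

Lemma pair_action_translates a b c :
    (forall z, c (a z) = (1, 0) + c z)%R ->
    (forall z, c (b z) = (0, 1) + c z)%R ->
  forall v z, c (pair_action a b v z) = (v + c z)%R.
Proof.
move=> ca cb [m n] z.
rewrite bijM (zexpg_translates ca) (zexpg_translates cb) addrA.
congr (_ + _)%R.
rewrite [LHS]surjective_pairing !raddfD !raddfMz /=.
by rewrite !mul0rz addr0 add0r !intz.
Qed.

(** [conj_free_actions] for actions of Z^2 given by their two generators. *)
Lemma conj_commuting_pairs a b a' b' c c' :
    commute a b -> commute a' b' ->
    (forall z, c (a z) = (1, 0) + c z)%R ->
    (forall z, c (b z) = (0, 1) + c z)%R ->
    (forall z, c' (a' z) = (1, 0) + c' z)%R ->
    (forall z, c' (b' z) = (0, 1) + c' z)%R ->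
    (forall z, c z = 0%R <-> c' z = 0%R) ->
  exists t : bijection X, t * a * t^-1 = a' /\ t * b * t^-1 = b'.
Proof.
move=> ab ab' ca cb ca' cb' cc'.
have [t tE] := conj_free_actions (pair_actionD ab) (pair_actionD ab')
  (pair_action_translates ca cb) (pair_action_translates ca' cb') cc'.
exists t; split.
  by have := tE (1, 0)%R; rewrite /pair_action /= !mulg1.
by have := tE (0, 1)%R; rewrite /pair_action /= !mul1g.
Qed.

End CommutingPairs.

(** * The Heisenberg group modulo pq *)

Section Heisenberg.

Variable R : pzRingType.

(** The triple (i, j, k) stands for a^i b^j u^k, where b a = a b u and u is
    central; [heis_a n] and [heis_b n] are left multiplication by a^n and by
    b^n. Since [a^p, b^q] is a power of u with exponent pq up to sign, it acts
    trivially as soon as pq = 0 in [R]. *)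
Definition heisenberg := (int * int * R)%type.

Fact heis_aK (n : int) :
  cancel (fun z : heisenberg => (z.1.1 + n, z.1.2, z.2))%R
         (fun z : heisenberg => (z.1.1 - n, z.1.2, z.2))%R.
Proof. by case=> [[i j] k] /=; rewrite addrK. Qed.

Fact heis_aVK (n : int) :
  cancel (fun z : heisenberg => (z.1.1 - n, z.1.2, z.2))%R
         (fun z : heisenberg => (z.1.1 + n, z.1.2, z.2))%R.
Proof. by case=> [[i j] k] /=; rewrite subrK. Qed.

Definition heis_a n := Bijection (heis_aK n) (heis_aVK n).

Fact heis_bK (n : int) :
  cancel (fun z : heisenberg => (z.1.1, z.1.2 + n, z.2 + (n * z.1.1)%:~R))%R
         (fun z : heisenberg => (z.1.1, z.1.2 - n, z.2 - (n * z.1.1)%:~R))%R.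
Proof. by case=> [[i j] k] /=; rewrite !addrK. Qed.

Fact heis_bVK (n : int) :
  cancel (fun z : heisenberg => (z.1.1, z.1.2 - n, z.2 - (n * z.1.1)%:~R))%R
         (fun z : heisenberg => (z.1.1, z.1.2 + n, z.2 + (n * z.1.1)%:~R))%R.
Proof. by case=> [[i j] k] /=; rewrite !subrK. Qed.

Definition heis_b n := Bijection (heis_bK n) (heis_bVK n).

Lemma heis_aX n : zexpg (heis_a 1) n = heis_a n.
Proof.
apply: zexpg_additive => m k; apply: bijection_ext => -[[i j] l].
by rewrite bijM /= -addrA (addrC m).
Qed.

Lemma heis_bX n : zexpg (heis_b 1) n = heis_b n.
Proof.
apply: zexpg_additive => m k; apply: bijection_ext => -[[i j] l].
by rewrite bijM /= -!addrA (addrC m) mulrDl intrD (addrC (_ %:~R)%R).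
Qed.

Lemma commute_heis m n :
  ((m * n)%:~R = 0 :> R)%R -> commute (heis_a m) (heis_b n).
Proof.
move=> mn; apply: bijection_ext => -[[i j] l]; rewrite !bijM /=.
by rewrite mulrDr intrD (mulrC n m) mn addr0.
Qed.

(** In Z^2 the two lattices < (p, 0), (-1, -q) > and < (p, -1), (0, -q) > have
    the same fundamental domain 0 <= i < |p|, 0 <= j < |q|, which gives the
    common transversal for the two actions; they are free because their
    projections to Z^2 are. *)
Lemma heisenberg_action (p q : int) :
    p <> 0%R -> q <> 0%R -> ((p * q)%:~R = 0 :> R)%R ->
  exists t : bijection heisenberg,
    t * heis_a p * t^-1 = (heis_b 1)^-1 * heis_a p /\
    t * (heis_b (- q) * (heis_a 1)^-1) * t^-1 = heis_b (- q).
Proof.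
move=> /eqP p0 /eqP q0 pq.
have a_comm n : commute (heis_a p) (heis_a n).
  by rewrite -(heis_aX n) -(heis_aX p);
    apply/commute_zexpg/commute_sym/commute_zexpg.
have b_comm n : commute (heis_b (- q)) (heis_b n).
  by rewrite -(heis_bX n) -(heis_bX (- q));
    apply/commute_zexpg/commute_sym/commute_zexpg.
have ab_comm : commute (heis_a p) (heis_b (- q)).
  by apply: commute_heis; rewrite mulrN mulrNz pq oppr0.
(* Coordinates in an orbit, found by reducing (i, j) to the box: for [c] the
   second generator brings j into range and shifts i, and then a^p brings i
   into range without moving j; for [c'] the first generator brings i into
   range and shifts j, and then b^-q brings j into range without moving i. *)
pose c (z : heisenberg) :=
  (((z.1.1 - (z.1.2 %/ q)%Z)%R %/ p)%Z, - (z.1.2 %/ q)%Z)%R.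
pose c' (z : heisenberg) :=
  ((z.1.1 %/ p)%Z, - ((z.1.2 + (z.1.1 %/ p)%Z)%R %/ q)%Z)%R.
have divDl (n d : int) : d != 0%R -> ((n + d)%R %/ d)%Z = (1 + (n %/ d)%Z)%R.
  by move=> d0; rewrite -(divzMDl _ _ d0) mul1r addrC.
have divBl (n d : int) : d != 0%R -> ((n - d)%R %/ d)%Z = (-1 + (n %/ d)%Z)%R.
  by move=> d0; rewrite -(divzMDl _ _ d0) mulN1r addrC.
apply: (@conj_commuting_pairs _ _ _ _ _ c c').
- by apply: commuteM => //; apply: commuteV.
- by apply/commute_sym/commuteM; [apply: commuteV|apply: commute_sym].
- move=> [[i j] k]; rewrite /c /= addrAC divDl //.
  by congr pair; rewrite add0r.
- move=> [[i j] k]; rewrite /c /= divBl //.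
  congr pair; last by rewrite opprD opprK.
  by rewrite add0r opprD opprK addrA subrK.
- move=> [[i j] k]; rewrite /c' /= divDl //.
  by congr pair; rewrite add0r addrA subrK.
- move=> [[i j] k]; rewrite /c' /= addrAC divBl //.
  by congr pair; rewrite ?add0r // opprD opprK.
- move=> [[i j] k]; rewrite /c /c' /=; split=> -[].
    move=> + /eqP; rewrite oppr_eq0 => + /eqP jq.
    by rewrite jq subr0 => ip; rewrite ip addr0 jq oppr0.
  move=> ip /eqP; rewrite ip addr0 oppr_eq0 => /eqP jq.
  by rewrite jq subr0 ip oppr0.
Qed.

Lemma heis_ab_neq : (1 != 0 :> R)%R ->
  heis_a 1 * heis_b 1 <> heis_b 1 * heis_a 1.
Proof.
move=> /eqP R1 /(congr1 (fun f : bijection _ => f (0, 0, 0)%R)).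
by rewrite !bijM /= => -[]; rewrite !add0r => /esym.
Qed.

End Heisenberg.

(** * Generalized torsion in the groups of 0-surgeries *)

(** The centre is reduced modulo N = |pq|; N > 1 keeps it non-trivial. *)
Lemma pi1_commutator_neq1 (p q : int) : p <> 0%R -> q <> 0%R ->
    (1 < `|(p * q)%R|)%N ->
  [~ pres_gen (double_twist_rels p q) gen_a,
     pres_gen (double_twist_rels p q) gen_b] <> 1.
Proof.
move=> p0 q0 pq_gt1; set N := `|(p * q)%R|%N.
have pq0 : ((p * q)%:~R = 0 :> 'Z_N)%R.
  apply/eqP; rewrite [(p * q)%R]intEsign -/N.
  by rewrite intrM -pmulrn pchar_Zp // mulr0.
have [t [ta tb]] := heisenberg_action p0 q0 pq0.
pose f (x : knot_gen) : bijection (heisenberg 'Z_N) :=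
  match x with
  | gen_a => heis_a _ 1
  | gen_b => heis_b _ 1
  | gen_t => t
  end.
rewrite -[commg _ _]/(gterm_eval (@pres_gen _ _) [~ Gen gen_a, Gen gen_b]).
rewrite -pi_gterm_eval => /pres_eqP ab1.
have /(gterm_eval_pres (f := f))/(_ _ _ ab1) :
    forall r, r \in double_twist_rels p q ->
      gterm_eval f r.1 = gterm_eval f r.2.
  move=> r; rewrite !inE => /or3P[]/eqP-> /=;
    rewrite !gterm_eval_zexpg /= ?heis_aX ?heis_bX //.
  - by rewrite -[RHS]tb !mulgA.
  - by apply/eqP/commgP/commute_sym/commute_heis.
move=> /= /eqP/commgP; apply: heis_ab_neq.
exact: oner_neq0.
Qed.

Lemma pi1_torsion (p q : int) : p <> 0%R -> q <> 0%R -> (1 < `|(p * q)%R|)%N ->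
  exists g : pi1_zero_surgery p q, generalized_torsion g.
Proof.
move=> p0 q0 pq_gt1.
set rels := double_twist_rels p q.
exists [~ pres_gen rels gen_a, pres_gen rels gen_b].
apply: (commutator_torsion p0 q0); last exact: pi1_commutator_neq1.
have /pres_eqP : pres_eq rels [~ zexpg (Gen gen_b) q, zexpg (Gen gen_a) p] 1.
  by apply: pres_rel; rewrite !inE eqxx !orbT.
rewrite !pi_gterm_eval /= !gterm_eval_zexpg /=.
by move=> /eqP/commgP/commute_sym.
Qed.

Theorem theorem1p1 (p q p' q' : int)
    (hp : p <> 0%R) (hq : q <> 0%R) (hp' : p' <> 0%R) (hq' : q' <> 0%R)
    (hpq : (p * q = p' * q')%R)
    (hpp' : p <> p' /\ p <> (- p')%R)
    (hpq' : p <> q' /\ p <> (- q')%R) :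
  (exists g : pi1_zero_surgery p q, generalized_torsion g) \/
  (exists g : pi1_zero_surgery p' q', generalized_torsion g).
Proof.
left; apply: pi1_torsion => //.
(* Otherwise |pq| = |p'q'| = 1, so that |p| = |p'|. *)
rewrite ltnNge; apply/negP => pq_le1.
have pq1 : (`|p| * `|q| = 1)%N by move: pq_le1; rewrite abszM; nia.
have pq1' : (`|p'| * `|q'| = 1)%N by rewrite -abszM -hpq abszM.
have : `|p|%N = 1%N /\ `|p'|%N = 1%N by nia.
by lia.
Qed.
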